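(* The (abstract) vertex-edge graph of a matroid polytope determines the dimension and combinatorial type of the polytope uniquely in the class of matroid polytopes. That is, if $M$ and $M'$ are matroids such that the vertex-edge graphs of the matroid polytopes $P(M)$ and $P(M')$ are isomorphic as unlabelled graphs, then $\dim P(M)=\dim P(M')$ and $P(M)$ and $P(M')$ are combinatorially equivalent.
   Context: A matroid $M$ on a finite ground set $E$ is given by its nonempty collection $\mathcal{B}$ of bases, satisfying: for all $A,B\in\mathcal{B}$ and $a\in A\setminus B$ there is $b\in B\setminus A$ with $(A\setminus\{a\})\cup\{b\}\in\mathcal{B}$ and $(B\setminus\{b\})\cup\{a\}\in\mathcal{B}$. Taking $E=\{1,\dots,n\}$, the matroid (base) polytope is $P(M)=\mathrm{conv}\{e_B : B\in\mathcal{B}\}\subset\mathbb{R}^n$, where $e_B=\sum_{i\in B}e_i$ and $e_i$ is the $i$-th standard basis vector. The vertex-edge graph of a polytope is the graph formed by its vertices and its one-dimensional faces. Two polytopes are combinatorially equivalent if there is an inclusion-preserving bijection between their face lattices. *)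

(* Defs.v *)
From HB Require Import structures.
From mathcomp Require Import all_boot all_order all_algebra.
From mathcomp Require Import boolp classical_sets functions reals.

Set Implicit Arguments.
Unset Strict Implicit.
Unset Printing Implicit Defensive.

Import Order.TTheory GRing.Theory Num.Theory.

Local Open Scope classical_set_scope.
Local Open Scope ring_scope.

Record matroid (n : nat) := Matroid {
  bases : {set {set 'I_n}};
  bases_neq0 : bases != finset.set0;
  bases_exchange : forall A B : {set 'I_n}, A \in bases -> B \in bases ->
    forall a, a \in A :\: B ->
    exists b, [/\ b \in B :\: A,
                  b |: (A :\ a) \in bases
                & a |: (B :\ b) \in bases]
}.

Section Polytopes.
Variables (R : realType) (n : nat).
Implicit Types (S P F : set 'rV[R]_n) (x y c : 'rV[R]_n).

Definition conv S : set 'rV[R]_n :=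
  [set x | exists (k : nat) (p : 'I_k -> 'rV[R]_n) (w : 'I_k -> R),
    [/\ forall i, S (p i), forall i, 0 <= w i, \sum_i w i = 1
      & x = \sum_i w i *: p i]].

Definition affine_hull S : set 'rV[R]_n :=
  [set x | exists (k : nat) (p : 'I_k -> 'rV[R]_n) (w : 'I_k -> R),
    [/\ forall i, S (p i), \sum_i w i = 1 & x = \sum_i w i *: p i]].

(* The linear subspace parallel to the affine hull of S; the default value 0 is
   only reached when S is empty (see directionP). *)
Definition direction S : {vspace 'rV[R]_n} :=
  xget 0%VS [set U : {vspace 'rV[R]_n} |
    [set` U] = [set x - y | x in affine_hull S & y in affine_hull S]].

Definition sdim S : int :=
  if `[< S = set0 >] then -1 else (\dim (direction S))%:Z.

Definition dotv c x : R := \sum_i c 0 i * x 0 i.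

(* c = 0 is allowed, so that P itself and the empty set are faces of P. *)
Definition is_face P F : Prop :=
  exists (c : 'rV[R]_n) (d : R),
    (forall x, P x -> dotv c x <= d) /\
    F = [set x | P x /\ dotv c x = d].

Definition faces P : set (set 'rV[R]_n) := [set F | is_face P F].

Definition indicator (B : {set 'I_n}) : 'rV[R]_n :=
  \sum_(i in B) delta_mx 0 i.

Definition matroid_polytope (M : matroid n) : set 'rV[R]_n :=
  conv [set indicator B | B in [set` bases M]].

End Polytopes.

Arguments indicator R {n} B.
Arguments matroid_polytope R {n} M _.

(* A graph is given by its vertex set inside T; adj is only meaningful on
   pairs of vertices. *)
Record graph (T : Type) := Graph {
  vert : set T;
  adj : T -> T -> Prop
}.

Definition graph_isomorphic (T T' : Type) (G : graph T) (G' : graph T') : Prop :=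
  exists2 f : T -> T', set_bij (vert G) (vert G') f &
    forall x y, vert G x -> vert G y -> (adj G x y <-> adj G' (f x) (f y)).

Definition vertex_edge_graph (R : realType) (n : nat) (P : set 'rV[R]_n) :
    graph 'rV[R]_n :=
  {| vert := [set x | is_face P [set x]];
     adj := fun x y => x <> y /\
       exists F, [/\ is_face P F, sdim F = 1, F x & F y] |}.

Definition combinatorially_equivalent (R : realType) (n n' : nat)
    (P : set 'rV[R]_n) (P' : set 'rV[R]_n') : Prop :=
  exists2 f : set 'rV[R]_n -> set 'rV[R]_n', set_bij (faces P) (faces P') f &
    forall F G, faces P F -> faces P G -> (F `<=` G <-> f F `<=` f G).

Section Direction.
Variables (R : realType) (n : nat).
Implicit Types (S : set 'rV[R]_n) (U : {vspace 'rV[R]_n}).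

Lemma affine_hull_comb3 S x y z (a : R) :
  affine_hull S x -> affine_hull S y -> affine_hull S z ->
  affine_hull S (z + a *: (x - y)).
Proof.
move=> [k1 [p1 [w1 [Sp1 s1 ->]]]] [k2 [p2 [w2 [Sp2 s2 ->]]]].
move=> [k3 [p3 [w3 [Sp3 s3 ->]]]].
pose p (i : 'I_(k1 + (k2 + k3))) := match fintype.split i with
  | inl j => p1 j | inr j => match fintype.split j with inl l => p2 l | inr l => p3 l end end.
pose w (i : 'I_(k1 + (k2 + k3))) := match fintype.split i with
  | inl j => a * w1 j
  | inr j => match fintype.split j with inl l => - a * w2 l | inr l => w3 l end end.
exists (k1 + (k2 + k3))%N, p, w; split.
- by move=> i; rewrite /p; case: fintype.split => [j|j] //; case: fintype.split.
- rewrite big_split_ord big_split_ord /=.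
  have -> : \sum_i w (lshift _ i) = a by
    rewrite -[RHS]mulr1 -s1 mulr_sumr; apply: eq_bigr => i _;
    rewrite /w (unsplitK (inl _)).
  have -> : \sum_i w (rshift k1 (lshift k3 i)) = - a by
    rewrite -[RHS]mulr1 -s2 mulr_sumr; apply: eq_bigr => i _;
    rewrite /w (unsplitK (inr _)) (unsplitK (inl _)).
  rewrite addrA subrr add0r -[RHS]s3; apply: eq_bigr => i _.
  by rewrite /w !(unsplitK (inr _)).
- rewrite big_split_ord big_split_ord /= scalerBr -scaleNr [LHS]addrC -addrA.
  rewrite !scaler_sumr; congr (_ + (_ + _)); apply: eq_bigr => i _;
    by rewrite /w /p ?(unsplitK (inr _)) ?(unsplitK (inl _)) ?scalerA.
Qed.

Lemma directionP S : S !=set0 ->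
  [set` direction S] =
    [set x - y | x in affine_hull S & y in affine_hull S].
Proof.
move=> [s Ss]; set L := RHS.
suff [U UL] : exists U : {vspace 'rV[R]_n}, [set` U] = L.
  by rewrite /direction; case: xgetP => [V _ //|/(_ U)].
have As : affine_hull S s.
  exists 1%N, (fun=> s), (fun=> 1); split=> //; first by rewrite big_ord1.
  by rewrite big_ord1 scale1r.
have L0 : L 0 by exists s => //; exists s => //; rewrite subrr.
have LD (a : R) u v : L u -> L v -> L (a *: u + v).
  move=> [x Ax [y Ay <-]] [z Az [t At <-]].
  exists (z + a *: (x - y)); first exact: affine_hull_comb3.
  by exists t => //; rewrite addrA [z + _]addrC.
pose Q k := `[< exists U, [set` U] `<=` L /\ \dim U = k >].
have Q0 : exists k, Q k.
  exists 0%N; apply/asboolP; exists 0%VS; split; last exact: dimv0.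
  by move=> x /=; rewrite memv0 => /eqP ->.
have Qb k : Q k -> (k <= \dim {:'rV[R]_n})%N.
  by move=> /asboolP [U [_ <-]]; exact: dimvS (subvf _).
case: (ex_maxnP Q0 Qb) => m /asboolP [U [UL dU]] maxm.
exists U; apply/seteqP; split=> // v Lv /=.
apply/negPn/negP => vU.
have /maxm : Q (\dim (U + <[v]>)%VS).
  apply/asboolP; exists (U + <[v]>)%VS; split=> //.
  move=> x /memv_addP [u uU [_ /vlineP [a ->] ->]].
  by rewrite addrC; apply: LD => //; exact: UL.
rewrite -dU => le; move: vU; apply/negP/negPn.
have /eqP -> : U == (U + <[v]>)%VS by rewrite eqEdim addvSl.
by rewrite (subvP (addvSr U <[v]>)) // memv_line.
Qed.

End Direction.

(* Main.v *)
Require Import Defs.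
From mathcomp Require Import all_boot all_order all_algebra.
From mathcomp Require Import boolp classical_sets functions reals.
From mathcomp Require Import zify ring lra.

(* Two bases are adjacent in the vertex-edge graph iff they differ by a single
   exchange, and four bases forming an induced 4-cycle W, X, Y, Z satisfy
   e_W + e_Y = e_X + e_Z.  Conversely, any function on the bases satisfying this
   parallelogram identity on induced 4-cycles is affine in the indicator vectors:
   around one basis B it is given by a potential on the ground set, since all
   alternating sums along closed walks in the fundamental graph of B vanish, and
   its values at B and the neighbours of B determine it by completing squares along
   geodesics.  Hence a graph isomorphism and its inverse both extend to affine
   maps, so the two polytopes are affinely isomorphic. *)

Set Implicit Arguments.
Unset Strict Implicit.
Unset Printing Implicit Defensive.

Import Order.TTheory GRing.Theory Num.Theory.
Local Open Scope ring_scope.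

(** * Single-element exchanges on finite sets *)

Section Exchange.
Variable T : finType.
Implicit Types (A B D : {set T}) (a b : T).

Definition exch B a b : {set T} := b |: (B :\ a).

Lemma mem_neq B a b : a \in B -> b \notin B -> (b == a) = false.
Proof. by move=> aB bB; apply: contraNF bB => /eqP ->. Qed.

Lemma in_exch B a b x : (x \in exch B a b) = (x == b) || (x != a) && (x \in B).
Proof. by rewrite !finset.inE. Qed.

Lemma exch_swap_out B a a' b b' : a \in B -> a' \in B -> b \notin B -> b' \notin B ->
  exch (exch B a b) a' b' = exch (exch B a' b) a b'.
Proof.
move=> aB a'B bB b'B; apply/setP => x; rewrite !in_exch.
case: eqP => //= _; case: (x =P b) => [->|_]; last by rewrite andbCA.
by rewrite !(mem_neq _ bB).
Qed.

Lemma exch_swap_in B a a' b b' : a \in B -> a' \in B -> b \notin B -> b' \notin B ->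
  exch (exch B a b) a' b' = exch (exch B a b') a' b.
Proof.
move=> aB a'B bB b'B; apply/setP => x; rewrite !in_exch.
case: (x =P b) => [->|_]; first by rewrite (mem_neq a'B bB) orbT.
by case: (x =P b') => [->|//]; rewrite (mem_neq a'B b'B).
Qed.

Lemma exch_back B a b c : b \notin B -> exch (exch B a b) b c = exch B a c.
Proof.
move=> bB; apply/setP => x; rewrite !in_exch.
by case: (x =P b) => [->|_] //=; rewrite (negPf bB) !andbF.
Qed.

Lemma exch_back_in B a b c : a \in B -> c \in B -> b \notin B -> a != c ->
  exch (exch B a b) c a = exch B c b.
Proof.
move=> aB cB bB ac; apply/setP => x; rewrite !in_exch.
case: (x =P a) => [->|_] /=; first by rewrite ac aB orbT.
by case: (x =P b) => [->|//]; rewrite (mem_neq cB bB).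
Qed.

Lemma exchD B a b : a \in B -> b \notin B -> B :\: exch B a b = [set a].
Proof.
move=> aB bB; apply/setP => x; rewrite !finset.inE.
case: (x =P a) => [->|_] /=; first by rewrite orbF aB eq_sym (mem_neq aB bB).
by rewrite negb_or -andbA andNb andbF.
Qed.

Lemma exch2D B a a' b b' : a \in B -> a' \in B -> b \notin B -> b' \notin B ->
  B :\: exch (exch B a b) a' b' = [set a; a'].
Proof.
move=> aB a'B bB b'B; apply/setP => x; rewrite !finset.inE.
case: (x =P b) => [->|_].
  by rewrite (negPf bB) (mem_neq aB bB) (mem_neq a'B bB) andbF.
case: (x =P b') => [->|_] /=.
  by rewrite (mem_neq aB b'B) (mem_neq a'B b'B).
case: (x =P a) => [->|_] /=; first by rewrite andbF aB.
case: (x =P a') => [->|_] /=; first by rewrite a'B.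
by rewrite andNb.
Qed.

Lemma exchDl A B a b : a \in A -> b \in B -> exch A a b :\: B = (A :\: B) :\ a.
Proof.
move=> aA bB; apply/setP => x; rewrite !finset.inE.
by case: (x =P b) => [->|_] /=; rewrite ?bB ?andbF // andbCA.
Qed.

Lemma card_exch B a b : a \in B -> b \notin B -> #|exch B a b| = #|B|.
Proof.
move=> aB bB; rewrite cardsU1 !finset.inE (negPf bB) andbF /=.
by rewrite [RHS](cardsD1 a) aB.
Qed.

End Exchange.

(** * Bases of a matroid and their fundamental graphs *)

Section BasisGraph.
Variables (n : nat) (M : matroid n).
Implicit Types (A B C D : {set 'I_n}) (a b : 'I_n).

Lemma exchange_basis A B a : A \in bases M -> B \in bases M -> a \in A -> a \notin B ->
  exists b, [/\ b \in B, b \notin A, exch A a b \in bases M & exch B b a \in bases M].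
Proof.
move=> AM BM aA aB.
have aAB : a \in A :\: B by rewrite finset.inE aB.
have [b [bBA Ab Ba]] := bases_exchange AM BM aAB.
by exists b; move: bBA; rewrite finset.inE => /andP[bA bB].
Qed.

(** Exchanging an element of [A :\: B] for one of [B] keeps the size of [A] and shrinks the
    difference. Once [A] is contained in [B], equality follows, since an element of [B :\: A] would
    have to be exchanged against one of the empty set [A :\: B]. *)
Lemma card_basis A B : A \in bases M -> B \in bases M -> #|A| = #|B|.
Proof.
move=> AM BM; have [m] := ubnP #|A :\: B|; elim: m => // m IH in A AM *.
rewrite ltnS => le_m; have [AB0|[a]] := set_0Vmem (A :\: B).
  have AB : A \subset B by rewrite -finset.setD_eq0 AB0.
  suff -> : A = B by []; apply/eqP; rewrite finset.eqEsubset AB /=.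
  apply/fintype.subsetP => b bB; apply/negPn/negP => bA.
  have [a [aA aB _ _]] := exchange_basis BM AM bB bA.
  by rewrite (fintype.subsetP AB) in aB.
rewrite finset.inE => /andP[aB aA].
have [b [bB bA AbM _]] := exchange_basis AM BM aA aB.
rewrite -(card_exch aA bA); apply: IH => //.
rewrite exchDl //; apply: leq_trans le_m.
by rewrite [X in (_ < X)%N](cardsD1 a) finset.inE aA aB.
Qed.

Lemma basisD_sym A B : A \in bases M -> B \in bases M -> #|A :\: B| = #|B :\: A|.
Proof. by move=> AM BM; rewrite !cardsD finset.setIC (card_basis AM BM). Qed.

Lemma basisD0 A B : A \in bases M -> B \in bases M -> #|A :\: B| = 0%N -> A = B.
Proof.
move=> AM BM /cards0_eq AB0; apply/eqP.
by rewrite eqEcard -finset.setD_eq0 AB0 eqxx (card_basis AM BM) /=.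
Qed.

(* The fundamental graph of B: bipartite, with parts B and its complement. *)
Definition edge B a b := [&& a \in B, b \notin B & exch B a b \in bases M].

Lemma edgeP B a b : edge B a b -> [/\ a \in B, b \notin B & exch B a b \in bases M].
Proof. by case/and3P. Qed.

(** Symmetric exchange of [a'] between the two neighbours of [B] can only bring in [b'] or [a]. The
    first gives the desired basis; the second would make both [(a, b')] and [(a', b)] edges. *)
Lemma exch2_basis B a a' b b' : B \in bases M -> a != a' -> b != b' ->
  edge B a b -> edge B a' b' -> ~~ (edge B a b' && edge B a' b) ->
  exch (exch B a b) a' b' \in bases M.
Proof.
move=> BM aa' bb' /edgeP[aB bB abM] /edgeP[a'B b'B a'b'M] Nd.
have a'C : a' \in exch B a b by rewrite in_exch a'B (eq_sym a' a) aa' orbT.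
have a'X : a' \notin exch B a' b' by rewrite in_exch eqxx orbF (eq_sym a' b') (mem_neq a'B b'B).
have [y [yX yC CyM XyM]] := exchange_basis abM a'b'M a'C a'X.
have /orP[/eqP yb'|/eqP ya] : (y == b') || (y == a).
  move: yX yC; rewrite !in_exch negb_or negb_and negbK => /orP[->//|/andP[_ yB]].
  by rewrite yB orbF => /andP[_ ->]; rewrite orbT.
- by rewrite -yb'.
- case/negP: Nd; rewrite /edge aB b'B a'B bB /=.
  move: CyM XyM; rewrite ya exch_back_in // exch_back_in //; last by rewrite eq_sym.
  by move=> -> ->.
Qed.

(** * Functions on bases that obey the parallelogram law *)

Section Potential.
Variables (R : realFieldType) (phi : {set 'I_n} -> R).

Definition parallelogram_law := forall B a a' b b',
  a != a' -> b != b' -> B \in bases M -> edge B a b -> edge B a' b' ->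
  exch (exch B a b) a' b' \in bases M ->
  phi B + phi (exch (exch B a b) a' b') = phi (exch B a b) + phi (exch B a' b').

Hypothesis phiP : parallelogram_law.

Definition weight B a b := phi (exch B a b) - phi B.

(** The four neighbours of [B] involved form a square themselves. The law, applied at the corner
    [exch B a b], gives the identity, because [phi B] cancels. *)
Lemma weight_square B a a' b b' : B \in bases M ->
  edge B a b -> edge B a b' -> edge B a' b -> edge B a' b' ->
  weight B a b + weight B a' b' = weight B a b' + weight B a' b.
Proof.
move=> BM /edgeP[aB bB abM] /edgeP[_ b'B ab'M] /edgeP[a'B _ a'bM] /edgeP[_ _ a'b'M].
have [->|aa'] := eqVneq a a'; first by rewrite addrC.
have [->//|bb'] := eqVneq b b'.
have e1 : exch (exch B a b) b b' = exch B a b' by rewrite exch_back.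
have e2 : exch (exch B a b) a' a = exch B a' b by rewrite exch_back_in.
have e3 : exch (exch (exch B a b) b b') a' a = exch B a' b'.
  by rewrite e1 exch_back_in.
have ba' : b != a' by rewrite (mem_neq a'B bB).
have b'a : b' != a by rewrite (mem_neq aB b'B).
have bC : b \in exch B a b by rewrite in_exch eqxx.
have a'C : a' \in exch B a b by rewrite in_exch a'B (eq_sym a' a) aa' orbT.
have b'C : b' \notin exch B a b.
  by rewrite in_exch (negPf b'B) andbF orbF eq_sym.
have aC : a \notin exch B a b.
  by rewrite in_exch eqxx /= orbF eq_sym (mem_neq aB bB).
have := @phiP (exch B a b) b a' b' a ba' b'a abM.
rewrite e3 e1 e2 /edge bC a'C b'C aC e1 e2 ab'M a'bM a'b'M => /(_ isT isT isT).
by rewrite /weight => ?; lra.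
Qed.

(** A missing diagonal makes the double exchange a basis by [exch2_basis]; the two weights are then
    differences along opposite sides of one parallelogram. *)
Lemma pivot_keep B a1 b1 a b : B \in bases M -> edge B a1 b1 -> edge B a b ->
  a != a1 -> b != b1 -> ~~ (edge B a1 b && edge B a b1) ->
  edge (exch B a1 b1) a b /\ weight (exch B a1 b1) a b = weight B a b.
Proof.
move=> BM e1 e aa1 bb1 Nd; have [a1B b1B _] := edgeP e1; have [aB bB _] := edgeP e.
have DM : exch (exch B a1 b1) a b \in bases M.
  by apply: exch2_basis; rewrite // eq_sym.
split.
  by rewrite /edge DM !in_exch aB aa1 orbT (negPf bB) andbF orbF bb1.
have := @phiP B a1 a b1 b; rewrite eq_sym aa1 eq_sym bb1 => /(_ isT isT BM e1 e DM).
by rewrite /weight => ?; lra.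
Qed.

(** The double exchange is reached through the other matching, [(a, b1)] and [(a1, b)], whose square
    supplies the weight. *)
Lemma pivot_new B a1 b1 a b : B \in bases M -> edge B a1 b1 ->
  edge B a b1 -> edge B a1 b -> ~~ edge B a b ->
  edge (exch B a1 b1) a b /\
  weight (exch B a1 b1) a b = weight B a b1 + weight B a1 b - weight B a1 b1.
Proof.
move=> BM e1 eab1 ea1b Nab; have [a1B b1B _] := edgeP e1.
have [[aB _ _] [_ bB _]] := (edgeP eab1, edgeP ea1b).
have aa1 : a != a1 by apply: contraNneq Nab => ->.
have bb1 : b1 != b by apply: contraNneq Nab => <-.
have DE : exch (exch B a1 b1) a b = exch (exch B a b1) a1 b by rewrite exch_swap_out.
have DM : exch (exch B a b1) a1 b \in bases M.
  by apply: exch2_basis => //; rewrite (negPf Nab).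
split.
  by rewrite /edge DE DM !in_exch aB aa1 orbT (negPf bB) andbF orbF eq_sym bb1.
have := @phiP B a a1 b1 b aa1 bb1 BM eab1 ea1b DM.
by rewrite /weight DE => ?; lra.
Qed.

(* A walk a = a1, b1, a2, b2, .. in the fundamental graph is encoded by its
   start a and the list of pairs (b1, a2), (b2, a3), .. *)
Fixpoint walk B a (s : seq ('I_n * 'I_n)) : bool :=
  if s is (b, a') :: s' then [&& edge B a b, edge B a' b & walk B a' s'] else true.

Fixpoint walk_sum B a (s : seq ('I_n * 'I_n)) : R :=
  if s is (b, a') :: s' then weight B a b - weight B a' b + walk_sum B a' s' else 0.

Lemma last_unzip2_cat a (s1 s2 : seq ('I_n * 'I_n)) :
  last a (unzip2 (s1 ++ s2)) = last (last a (unzip2 s1)) (unzip2 s2).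
Proof. by rewrite /unzip2 map_cat last_cat. Qed.

Lemma walk_cat B a s1 s2 :
  walk B a (s1 ++ s2) = walk B a s1 && walk B (last a (unzip2 s1)) s2.
Proof. by elim: s1 a => [//|[b a'] s1 IH] a /=; rewrite IH !andbA. Qed.

Lemma walk_sum_cat B a s1 s2 :
  walk_sum B a (s1 ++ s2) = walk_sum B a s1 + walk_sum B (last a (unzip2 s1)) s2.
Proof. by elim: s1 a => [|[b a'] s1 IH] a /=; rewrite ?add0r // IH addrA. Qed.

(** As no outer vertex of the walk is adjacent to [a1], the walk also avoids [a1] and [b1], and
    [pivot_keep] applies to each of its edges. *)
Lemma walk_pivot B a1 b1 a s : B \in bases M -> edge B a1 b1 ->
  all (fun p => ~~ edge B a1 p.1) s -> a != a1 -> walk B a s ->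
  walk (exch B a1 b1) a s /\ walk_sum (exch B a1 b1) a s = walk_sum B a s.
Proof.
move=> BM e1; elim: s a => [//|[b a'] s IH] a /= /andP[Nb Ns] aa1 /and3P[eab ea'b ws].
have a'a1 : a' != a1 by apply: contraNneq Nb => <-.
have bb1 : b != b1 by apply: contraNneq Nb => ->.
have [ws' ->] := IH a' Ns a'a1 ws.
have [|-> ->] := pivot_keep BM e1 eab aa1 bb1; first by rewrite (negPf Nb).
by have [|-> ->] := pivot_keep BM e1 ea'b a'a1 bb1; first by rewrite (negPf Nb).
Qed.

(* Induction on the length, over all bases simultaneously: a chord at a, or an edge
   closing a 4-cycle with a, splits off a shorter closed walk; otherwise pivoting on
   the first edge (a, b1) turns a2 - b1 - a - bk into the single edge (a2, bk). *)
Lemma closed_walk_sum B a s : B \in bases M ->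
  walk B a s -> last a (unzip2 s) = a -> walk_sum B a s = 0.
Proof.
have [m] := ubnP (size s); elim: m => // m IH in B a s *.
(* A closed walk with a single pair runs back and forth along one edge. Any longer one is cut into a
   first pair, a middle [t] and a last pair. *)
case: s => [//|[b1 a2] s']; case/lastP: s' => [|t [bk a']].
  by move=> _ BM /= _ ->; rewrite subrr addr0.
have walkE := (walk_cat, walk_sum_cat, last_unzip2_cat, size_cat).
rewrite -cats1 /= size_cat addn1 ltnS => szt BM.
rewrite !walkE /= andbT.
set ak := last a2 _ => /and5P[e1 e2 wt ek e]; move=> aa; rewrite aa {a' aa} in e *.
have [/hasP[[b c] /= pt eb]|Nt] := boolP (has (fun p => edge B a p.1) t).
  rewrite {}/ak in ek *; case/splitPr: pt => t1 t2 in szt wt ek *.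
  move: szt wt ek; rewrite !walkE /= => szt /and4P[wt1 eb' ec wt2] ek.
  have := IH B a ((b1, a2) :: t1 ++ [:: (b, a)]).
  have := IH B a ((b, c) :: t2 ++ [:: (bk, a)]).
  rewrite /= !walkE /= e1 e2 wt1 eb' eb ec wt2 ek e !addn1 => h1 h2.
  have /h1/(_ BM isT erefl) : ((size t2).+2 < m)%N.
    by apply: leq_ltn_trans szt; rewrite ltnS leq_addl.
  have /h2/(_ BM isT erefl) : ((size t1).+2 < m)%N.
    by apply: leq_ltn_trans szt; rewrite addnS !ltnS leq_addr.
  by move=> ? ?; lra.
(* By [weight_square], the edge [(a2, bk)] can replace the three edges through [b1] and [a] with the
   same alternating sum. The edge [(ak, b1)] is treated likewise. *)
have [e2k|N2k] := boolP (edge B a2 bk).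
  have := IH B a2 (t ++ [:: (bk, a2)]).
  rewrite /= !walkE /= wt ek e2k addn1 => /(_ szt BM isT erefl).
  by have := weight_square BM e1 e e2 e2k; rewrite -/ak => ? ?; lra.
have [ek1|Nk1] := boolP (edge B ak b1).
  have := IH B a2 (t ++ [:: (b1, a2)]).
  rewrite /= !walkE /= wt ek1 e2 addn1 => /(_ szt BM isT erefl).
  by have := weight_square BM e1 e ek1 ek; rewrite -/ak => ? ?; lra.
have a2a : a2 != a by apply: contraNneq N2k => ->.
have aka : ak != a by apply: contraNneq Nk1 => ->.
have bkb1 : bk != b1 by apply: contraNneq Nk1 => <-.
have [_ _ CM] := edgeP e1.
rewrite -all_predC in Nt.
have [wt' st'] := walk_pivot BM e1 Nt a2a wt.
have [|ek' sk'] := pivot_keep BM e1 ek aka bkb1; first by rewrite (negPf Nk1) andbF.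
have [e2k' s2k'] := pivot_new BM e1 e2 e N2k.
have := IH (exch B a b1) a2 (t ++ [:: (bk, a2)]).
rewrite /= !walkE /= wt' ek' e2k' addn1 => /(_ szt CM isT erefl).
by rewrite st' -/ak sk' s2k' => ?; lra.
Qed.

Lemma walk_rev B a s : walk B a s -> exists s',
  [/\ walk B (last a (unzip2 s)) s', last (last a (unzip2 s)) (unzip2 s') = a
    & walk_sum B (last a (unzip2 s)) s' = - walk_sum B a s].
Proof.
elim: s a => [|[b a'] s IH] a /=; first by exists [::]; rewrite /= oppr0.
move=> /and3P[eab ea'b /IH[s' [ws' ls' ss']]].
exists (s' ++ [:: (b, a)]).
rewrite walk_cat walk_sum_cat last_unzip2_cat ls' /= ws' eab ea'b ss'; split=> //.
by lra.
Qed.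

(** Its connected classes inside [B] are the traces of the components of the fundamental graph. *)
Definition linked B a a' := [exists b, edge B a b && edge B a' b].

Lemma connect_walk B a a' : connect (linked B) a a' ->
  exists2 s, walk B a s & last a (unzip2 s) = a'.
Proof.
case/connectP => p; elim: p a => [a _ ->|c p IH a /= /andP[/existsP[b /andP[ea ec]] cp]].
  by exists [::].
by case/(IH _ cp) => s ws <-; exists ((b, c) :: s); rewrite //= ea ec.
Qed.

Lemma linked_sym B : connect_sym (linked B).
Proof.
by apply: sym_connect_sym => a a'; apply: eq_existsb => b; rewrite andbC.
Qed.

(** On [B] the potential is the alternating sum along a walk from the root of the component; outside
    [B] it is extended along one chosen edge. Vanishing of closed walks makes it independent of
    these choices. *)
Lemma local_potential B : B \in bases M ->
  exists p : 'I_n -> R, forall a b, edge B a b -> weight B a b = p b - p a.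
Proof.
move=> BM; pose r := fingraph.root (linked B).
have /choice[f fP] : forall a, exists s, walk B (r a) s /\ last (r a) (unzip2 s) = a.
  move=> a; have : connect (linked B) (r a) a by rewrite linked_sym connect_root.
  by case/connect_walk => s; exists s.
pose pA a := walk_sum B (r a) (f a).
(* The default 0 goes to elements outside [B] without any edge, on which the conclusion puts no
   condition. *)
pose p i := if i \in B then pA i else
  if [pick a | edge B a i] is Some a then pA a + weight B a i else 0.
exists p => a b eab; have [aB bB _] := edgeP eab.
rewrite /p aB (negPf bB); case: pickP => [a0 ea0b|/(_ a)]; last by rewrite eab.
have rE : r a0 = r a.
  apply/eqP; rewrite (root_connect (linked_sym B)); apply: connect1.
  by apply/existsP; exists b; rewrite ea0b.
have [[w0 l0] [w1 l1]] := (fP a0, fP a).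
have [s [ws ls ss]] := walk_rev w1; rewrite l1 in ws ls ss.
(* The closed walk goes from the root to [a0], through [b] to [a], and back to the common root. *)
have := @closed_walk_sum B (r a0) (f a0 ++ (b, a) :: s) BM.
rewrite walk_cat walk_sum_cat last_unzip2_cat /= l0 w0 ea0b eab ws ls rE ss.
by move=> /(_ isT erefl); rewrite /pA rE => ?; lra.
Qed.

Lemma sum_exch (p : 'I_n -> R) B a b : a \in B -> b \notin B ->
  \sum_(i in exch B a b) p i = \sum_(i in B) p i + p b - p a.
Proof.
move=> aB bB; rewrite big_setU1 /=; last by rewrite !finset.inE (negPf bB) andbF.
by rewrite [X in _ = X + _ - _](big_setD1 a) //=; lra.
Qed.

Lemma exchK B a b : a \in B -> b \notin B -> exch (exch B a b) b a = B.
Proof. by move=> aB bB; rewrite exch_back // /exch finset.setD1K. Qed.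

(** The potential at one fixed basis [B] settles [B] and its neighbours. Induction on the distance
    to [B] settles the others, the law determining a corner of a square from three corners closer to
    [B]. *)
Lemma affine_on_bases : exists (k : R) (p : 'I_n -> R),
  forall D, D \in bases M -> phi D = k + \sum_(i in D) p i.
Proof.
have /set0Pn[B BM] := bases_neq0 M.
have [p pP] := local_potential BM.
exists (phi B - \sum_(i in B) p i), p => D.
have [m] := ubnP #|D :\: B|; elim: m => // m IH in D *; rewrite ltnS => le_m DM.
have [DB0|[a]] := set_0Vmem (D :\: B).
  by rewrite (basisD0 DM BM) ?DB0 ?cards0 //; lra.
rewrite finset.inE => /andP[aB aD].
have [b [bB bD D1M _]] := exchange_basis DM BM aD aB.
have [D1B0|[a']] := set_0Vmem (exch D a b :\: B).
  have D1B : exch D a b = B by apply: basisD0; rewrite // D1B0 cards0.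
  have DE : D = exch B b a by rewrite -D1B exchK.
  have /pP : edge B b a by rewrite /edge bB aB -DE.
  by rewrite DE sum_exch // /weight => ?; lra.
rewrite finset.inE in_exch => /andP[a'B /orP[/eqP a'b|/andP[a'a a'D]]].
  by rewrite a'b bB in a'B.
have a'D1 : a' \in exch D a b by rewrite in_exch a'a a'D orbT.
have [b' [b'B b'D1 D2M _]] := exchange_basis D1M BM a'D1 a'B.
have b'a : b' != a by apply: contraNneq aB => <-.
have [b'b b'D] : b' != b /\ b' \notin D.
  by move: b'D1; rewrite in_exch b'a /= negb_or => /andP[].
have aD2 : a \notin exch (exch D a b) a' b'.
  by rewrite !in_exch eqxx /= orbF negb_or (eq_sym a b') b'a (eq_sym a b)
     (mem_neq aD bD) andbF.
(* D, the basis obtained by two steps towards B, and two common neighbours of these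
   form a square whose corners other than D are closer to B. *)
have [c [cD2 cD DacM D2caM]] := exchange_basis DM D2M aD aD2.
have [c' [cc' [cB c'B] c'D [Da'c'M DaccM]]] : exists c', [/\ c != c', c \in B /\ c' \in B,
    c' \notin D & exch D a' c' \in bases M /\ exch (exch D a c) a' c' \in bases M].
  (* The element [c] is [b'] or [b], and [c'] is the other one. In both cases the corner opposite
     [D] is the basis found after two steps. *)
  move: cD2; rewrite !in_exch (negPf cD) !andbF orbF.
  case/orP => [/eqP cb'|/andP[_ /eqP cb]].
    exists b; rewrite cb' b'b; split=> //.
    move: D2caM; rewrite cb' exch_back // exch_back_in //; last by rewrite eq_sym.
    by rewrite exch_swap_in.
  exists b'; rewrite cb eq_sym b'b; split=> //; split=> //.
  move: D2caM; rewrite cb exch_swap_out //; last 2 first.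
  - by rewrite in_exch eqxx.
  - by rewrite in_exch eqxx /= orbF (eq_sym a b) (mem_neq aD bD).
  rewrite exch_back //.
  by rewrite exch_back_in // eq_sym.
have law : phi D + phi (exch (exch D a c) a' c') = phi (exch D a c) + phi (exch D a' c').
  by apply: phiP; rewrite // /edge ?aD ?cD ?a'D ?c'D // eq_sym.
have lt_m x : x \in D -> x \notin B -> (#|(D :\: B) :\ x| < m)%N.
  move=> xD xB; apply: leq_trans le_m.
  by rewrite [X in (_ < X)%N](cardsD1 x) finset.inE xD xB.
have := IH _ _ DacM; rewrite exchDl // lt_m // => /(_ isT).
have := IH _ _ Da'c'M; rewrite exchDl // lt_m // => /(_ isT).
have := IH _ _ DaccM; rewrite exchDl //; last by rewrite in_exch a'a a'D orbT.
rewrite exchDl // (leq_ltn_trans _ (lt_m a aD aB)) ?subset_leq_card ?finset.subD1set //.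
move=> /(_ isT); rewrite !sum_exch //; last 2 first.
- by rewrite in_exch a'a a'D orbT.
- by rewrite in_exch (negPf c'D) andbF orbF eq_sym.
by move=> ? ? ?; lra.
Qed.

End Potential.

End BasisGraph.

(** * Indicator vectors and affine extension of basis graph maps *)

Section Indicators.
Variables (R : realType) (n : nat).
Implicit Types (A B : {set 'I_n}) (c x : 'rV[R]_n).

Lemma indicatorE B i : indicator R B 0 i = (i \in B)%:R.
Proof.
rewrite summxE (eq_bigr (fun j => (j == i)%:R)); last first.
  by move=> j _; rewrite mxE eqxx eq_sym.
have [iB|iB] := boolP (i \in B).
  rewrite (bigD1 i) //= eqxx big1 ?addr0 // => j /andP[_ /negPf->] //.
by rewrite big1 // => j jB; case: eqP => // ji; rewrite -ji jB in iB.
Qed.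

Lemma indicator_inj : injective (@indicator R n).
Proof.
move=> A B /rowP AB; apply/setP => i; have := AB i.
by rewrite !indicatorE => /eqP; rewrite eqr_nat; case: (i \in A); case: (i \in B).
Qed.

Lemma dotv_indicator A B : dotv (indicator R A) (indicator R B) = #|A :&: B|%:R.
Proof.
rewrite /dotv -sum1_card natr_sum [RHS]big_mkcond; apply: eq_bigr => i _.
by rewrite !indicatorE finset.inE; case: (i \in A); rewrite ?mul1r ?mul0r //; case: (i \in B).
Qed.

Lemma dotv_sum c k (w : 'I_k -> R) (p : 'I_k -> 'rV[R]_n) :
  dotv c (\sum_i w i *: p i) = \sum_i w i * dotv c (p i).
Proof.
rewrite /dotv; under [RHS]eq_bigr do rewrite mulr_sumr.
rewrite exchange_big /=; apply: eq_bigr => j _; rewrite summxE mulr_sumr.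
by apply: eq_bigr => i _; rewrite mxE mulrCA.
Qed.

Lemma dotvDr c x y : dotv c (x + y) = dotv c x + dotv c y.
Proof. by rewrite /dotv -big_split; apply: eq_bigr => i _; rewrite mxE mulrDr. Qed.

Lemma dotvDl c1 c2 x : dotv (c1 + c2) x = dotv c1 x + dotv c2 x.
Proof. by rewrite /dotv -big_split; apply: eq_bigr => i _; rewrite mxE mulrDl. Qed.

Lemma sum_sqr_indicator A B : #|A :\: B| = #|B :\: A| ->
  \sum_i (indicator R A 0 i - indicator R B 0 i) ^+ 2 = (#|A :\: B|).*2%:R.
Proof.
move=> AB; rewrite -addnn {2}AB natrD -!sum1_card !natr_sum.
rewrite [X in _ = X + _]big_mkcond [X in _ = _ + X]big_mkcond -big_split.
apply: eq_bigr => i _; rewrite !indicatorE !finset.inE.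
by case: (i \in A); case: (i \in B); rewrite /= ?subrr ?subr0 ?sub0r ?sqrrN
  ?expr1n ?expr0n ?addr0 ?add0r.
Qed.

(* As its coefficients sum to 0, W - X + Y - Z has as squared norm a signed sum of
   the six squared distances, here at most 4 * 2 - 2 * 4 = 0. *)
Lemma induced_square_indicator (M : matroid n) (W X Y Z : {set 'I_n}) :
  W \in bases M -> X \in bases M -> Y \in bases M -> Z \in bases M ->
  #|W :\: X| = 1%N -> #|X :\: Y| = 1%N -> #|Y :\: Z| = 1%N -> #|Z :\: W| = 1%N ->
  (1 < #|W :\: Y|)%N -> (1 < #|X :\: Z|)%N ->
  indicator R W + indicator R Y = indicator R X + indicator R Z.
Proof.
move=> WM XM YM ZM WX XY YZ ZW WY XZ.
pose e B i : R := indicator R B 0 i.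
have sq B C : B \in bases M -> C \in bases M ->
    \sum_i (e B i - e C i) ^+ 2 = (#|B :\: C|).*2%:R.
  by move=> BM CM; apply: sum_sqr_indicator; apply: basisD_sym BM CM.
have s0 : \sum_i (e W i - e X i + e Y i - e Z i) ^+ 2 =
    \sum_i (e W i - e X i) ^+ 2 + \sum_i (e X i - e Y i) ^+ 2 +
    \sum_i (e Y i - e Z i) ^+ 2 + \sum_i (e Z i - e W i) ^+ 2 -
    \sum_i (e W i - e Y i) ^+ 2 - \sum_i (e X i - e Z i) ^+ 2.
  by rewrite -!sumrN -!big_split; apply: eq_bigr => i _ /=; ring.
have le0 : \sum_i (e W i - e X i + e Y i - e Z i) ^+ 2 <= 0.
  rewrite s0 !sq // WX XY YZ ZW -addrA -opprD -!natrD subr_le0 ler_nat.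
  by move: WY XZ; lia.
have ge0 i : true -> 0 <= (e W i - e X i + e Y i - e Z i) ^+ 2 by rewrite sqr_ge0.
have /eqP := le_anti (introT andP (conj le0 (sumr_ge0 _ ge0))).
rewrite psumr_eq0 // => /allP z; apply/rowP => i; rewrite !mxE -/(e _ _).
have := z i (mem_index_enum _); rewrite sqrf_eq0 => /eqP; rewrite /e => ?; lra.
Qed.

End Indicators.

(** Each coordinate of the indicator of [g D] obeys the parallelogram law, since [g] sends squares
    to induced 4-cycles. [affine_on_bases] then yields one entry of [v] and one column of [A] per
    coordinate. *)
Lemma basis_graph_affine (R : realType) (n n' : nat) (M : matroid n) (M' : matroid n')
    (g : {set 'I_n} -> {set 'I_n'}) :
  {in bases M, forall D, g D \in bases M'} -> {in bases M &, injective g} ->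
  {in bases M &, forall D E, #|D :\: E| = 1%N <-> #|g D :\: g E| = 1%N} ->
  exists (v : 'rV[R]_n') (A : 'M[R]_(n, n')),
    {in bases M, forall D, indicator R (g D) = v + indicator R D *m A}.
Proof.
move=> gM g_inj g1.
have law j : parallelogram_law M (fun D => indicator R (g D) 0 j).
  move=> B a a' b b' aa' bb' BM /edgeP[aB bB abM] /edgeP[a'B b'B a'b'M] DM.
  set X := exch B a b in abM DM *; set Y := exch X a' b' in DM *.
  set Z := exch B a' b' in a'b'M *.
  have YE : Y = exch Z a b by rewrite /Y /X /Z exch_swap_out // exch_swap_in //
    ?exch_swap_out.
  have a'X : a' \in X by rewrite in_exch a'B (eq_sym a' a) aa' orbT.
  have b'X : b' \notin X by rewrite in_exch (negPf b'B) andbF orbF eq_sym.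
  have bX : b \in X by rewrite in_exch eqxx.
  have aX : a \notin X by rewrite in_exch eqxx /= orbF eq_sym (mem_neq aB bB).
  have aZ : a \in Z by rewrite in_exch aB aa' orbT.
  have bZ : b \notin Z by rewrite in_exch (negPf bB) andbF orbF.
  have ZE : Z = exch (exch X b b') a' a.
    by rewrite /X exch_back // exch_back_in.
  have BX : #|B :\: X| = 1%N by rewrite exchD // cards1.
  have XY : #|X :\: Y| = 1%N by rewrite exchD // cards1.
  have YZ : #|Y :\: Z| = 1%N by rewrite (basisD_sym DM a'b'M) YE exchD // cards1.
  have ZB : #|Z :\: B| = 1%N by rewrite (basisD_sym a'b'M BM) exchD // cards1.
  have BY : #|B :\: Y| = 2%N by rewrite exch2D // cards2 aa'.
  have XZ : #|X :\: Z| = 2%N by rewrite ZE exch2D // cards2 (mem_neq a'B bB).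
  (* Diagonals stay diagonals: the images are distinct by injectivity and not adjacent by [g1]. *)
  have far D E : D \in bases M -> E \in bases M -> #|D :\: E| = 2%N -> (1 < #|g D :\: g E|)%N.
    move=> DB EB DE; rewrite ltn_neqAle eq_sym; apply/andP; split.
      by apply/eqP => /(g1 _ _ DB EB); rewrite DE.
    rewrite lt0n; apply/eqP => /(basisD0 (gM _ DB) (gM _ EB)) /(g_inj _ _ DB EB) ED.
    by move: DE; rewrite ED finset.setDv cards0.
  have /rowP/(_ j) := induced_square_indicator R (gM _ BM) (gM _ abM) (gM _ DM) (gM _ a'b'M)
    ((g1 _ _ BM abM).1 BX) ((g1 _ _ abM DM).1 XY) ((g1 _ _ DM a'b'M).1 YZ)
    ((g1 _ _ a'b'M BM).1 ZB) (far _ _ BM DM BY) (far _ _ abM a'b'M XZ).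
  by rewrite !mxE.
have /choice[k /choice[p kp]] := fun j => affine_on_bases (@law j).
exists (\row_j k j), (\matrix_(i, j) p j i) => D DM; apply/rowP => j.
rewrite kp // !mxE; congr (_ + _).
rewrite [LHS]big_mkcond; apply: eq_bigr => i _; rewrite indicatorE mxE.
by case: (i \in D); rewrite ?mul1r ?mul0r.
Qed.

(** * Convex hulls, their faces and directions *)

Section Convexity.
Variables (R : realType) (n : nat).
Implicit Types (S : set 'rV[R]_n) (x y c : 'rV[R]_n).
Local Open Scope classical_set_scope.

Lemma sub_conv S : S `<=` conv S.
Proof.
move=> x Sx; exists 1%N, (fun=> x), (fun=> 1); split=> //; first by rewrite big_ord1.
by rewrite big_ord1 scale1r.
Qed.

Lemma sub_affine_hull S : S `<=` affine_hull S.
Proof.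
move=> x Sx; exists 1%N, (fun=> x), (fun=> 1); split=> //; first by rewrite big_ord1.
by rewrite big_ord1 scale1r.
Qed.

Lemma conv_dotv_le S c d : (forall x, S x -> dotv c x <= d) ->
  forall x, conv S x -> dotv c x <= d.
Proof.
move=> Sd _ [k [p [w [Sp w0 w1 ->]]]]; rewrite dotv_sum -[leRHS]mul1r -w1 mulr_suml.
by apply: ler_sum => i _; rewrite ler_wpM2l // Sd.
Qed.

(** The nonnegative terms [w i * (d - dotv c (p i))] sum to 0, so every point of nonzero weight is
    tight. *)
Lemma conv_face S c d x : (forall y, S y -> dotv c y <= d) ->
  conv S x -> dotv c x = d -> conv [set y | S y /\ dotv c y = d] x.
Proof.
move=> Sd [k [p [w [Sp w0 w1 ->]]]]; rewrite dotv_sum => cd.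
have tight i : w i != 0 -> dotv c (p i) = d.
  have /eqP : \sum_i w i * (d - dotv c (p i)) = 0.
    under eq_bigr do rewrite mulrBr.
    by rewrite sumrB -mulr_suml w1 mul1r cd subrr.
  rewrite psumr_eq0; last by move=> j _; rewrite mulr_ge0 // subr_ge0 Sd.
  move=> /allP/(_ i (mem_index_enum _)) /=; rewrite mulf_eq0 => /orP[->//|].
  by rewrite subr_eq0 => /eqP.
have [i0 wi0] : exists i, w i != 0.
  apply: contrapT => /forallNP w_0.
  move: w1; rewrite big1 => [/eqP|i _]; first by rewrite eq_sym oner_eq0.
  by apply/eqP/negPn/negP; apply: w_0.
(* Points of weight 0 need not be tight; the tight point [p i0] takes their place. *)
exists k, (fun i => if w i == 0 then p i0 else p i), w; split=> //.
  by move=> i; case: ifPn => [_|wi]; split=> //; apply: tight.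
by apply: eq_bigr => i _; case: ifPn => // /eqP ->; rewrite !scale0r.
Qed.

Lemma conv_set1 y x : conv [set y] x -> x = y.
Proof.
move=> [k [p [w [Sp w0 w1 ->]]]]; rewrite -[RHS]scale1r -w1 scaler_suml.
by apply: eq_bigr => i _; rewrite Sp.
Qed.

Lemma conv_nonempty S x : conv S x -> S !=set0.
Proof.
move=> [[|k] [p [w [Sp w0 w1 _]]]]; last by exists (p ord0).
by move: w1; rewrite big_ord0 => /eqP; rewrite eq_sym oner_eq0.
Qed.

Lemma affine_hull_span S x0 (U : {vspace 'rV[R]_n}) :
  (forall x, S x -> x - x0 \in U) -> forall x, affine_hull S x -> x - x0 \in U.
Proof.
move=> SU _ [k [p [w [Sp w1 ->]]]].
rewrite -[x0]scale1r -w1 scaler_suml -sumrB.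
by apply: memv_suml => i _; rewrite -scalerBr memvZ // SU.
Qed.

Lemma direction_sub S x0 (U : {vspace 'rV[R]_n}) : S !=set0 ->
  (forall x, S x -> x - x0 \in U) -> (direction S <= U)%VS.
Proof.
move=> S0 SU; apply/subvP => v.
have /seteqP[/(_ v) + _] := directionP S0 => /[apply] -[x Sx [y Sy <-]].
have -> : x - y = (x - x0) - (y - x0) by rewrite opprB addrA subrK.
by rewrite rpredB // (affine_hull_span SU).
Qed.

Lemma mem_direction S x y : S x -> S y -> x - y \in direction S.
Proof.
move=> Sx Sy; have S0 : S !=set0 by exists x.
have /seteqP[_ /(_ (x - y))] := directionP S0; apply.
by exists x; [exact: sub_affine_hull|exists y => //; exact: sub_affine_hull].
Qed.

Lemma sdimE S : S !=set0 -> sdim S = (\dim (direction S))%:Z.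
Proof. by move=> /set0P/eqP S0; rewrite /sdim; case: asboolP. Qed.

End Convexity.

(** * Vertices and edges of the matroid polytope *)

Section Polytope.
Variables (R : realType) (n : nat) (M : matroid n).
Implicit Types (B D E : {set 'I_n}).
Local Open Scope classical_set_scope.
Notation P := (matroid_polytope R M).
Notation ind := (indicator R).

Lemma indicator_polytope B : B \in bases M -> P (ind B).
Proof. by move=> BM; apply: sub_conv; exists B. Qed.

Lemma polytope_dotv_le c d : (forall B, B \in bases M -> dotv c (ind B) <= d) ->
  forall x, P x -> dotv c x <= d.
Proof. by move=> Bd; apply: conv_dotv_le => _ [B BM <-]; apply: Bd. Qed.

Lemma polytope_face c d x : (forall B, B \in bases M -> dotv c (ind B) <= d) ->
  P x -> dotv c x = d ->
  conv [set ind B | B in [set B | B \in bases M /\ dotv c (ind B) = d]] x.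
Proof.
move=> Bd Px cx; have [|k [p [w [Sp w0 w1 ->]]]] := conv_face _ Px cx.
  by move=> _ [B BM <-]; apply: Bd.
exists k, p, w; split=> // i.
by have [[B BM <-] cd] := Sp i; exists B.
Qed.

(** Thus the functional of [ind B] measures the distance to [B]. The truncated subtraction is exact,
    as [B :\: E] lies in [B]. *)
Lemma dotv_basis B E : B \in bases M -> E \in bases M ->
  dotv (ind B) (ind E) = (#|B| - #|B :\: E|)%:R.
Proof. by move=> BM EM; rewrite dotv_indicator -(cardsID E B) addnK. Qed.

(** A face contains the indicator of some tight basis, which is the only point of a singleton face.
    Conversely, [B] is the only basis that maximizes the functional of [ind B]. *)
Lemma vertexP x : vert (vertex_edge_graph P) x <-> exists2 B, B \in bases M & x = ind B.
Proof.
split=> [[c [d [Pd xF]]]|[B BM ->]].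
  have [Px cx] : P x /\ dotv c x = d by have : [set x] x by []; rewrite xF.
  have Bd B : B \in bases M -> dotv c (ind B) <= d.
    by move=> BM; apply/Pd/indicator_polytope.
  have [_ [B [BM cB] _]] := conv_nonempty (polytope_face Bd Px cx).
  exists B => //; apply/esym; suff : [set x] (ind B) by [].
  by rewrite xF; split=> //; apply: indicator_polytope.
have le E : E \in bases M -> dotv (ind B) (ind E) <= #|B|%:R.
  by move=> EM; rewrite dotv_basis // ler_nat leq_subr.
exists (ind B), #|B|%:R; split; first exact: polytope_dotv_le.
apply/seteqP; split=> [_ ->|y [Py cy]].
  split; first exact: indicator_polytope.
  by rewrite dotv_basis // finset.setDv cards0 subn0.
apply: conv_set1; have [k [p [w [Sp w0 w1 ->]]]] := polytope_face le Py cy.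
exists k, p, w; split=> // i; have [E [EM] + <-] := Sp i.
rewrite dotv_basis // => /eqP; rewrite eqr_nat => /eqP BE.
suff -> : B = E by []; apply: (basisD0 BM EM); apply/eqP.
by move: BE (subset_leq_card (finset.subsetDl B E)); lia.
Qed.

Lemma adjP B D : B \in bases M -> D \in bases M ->
  adj (vertex_edge_graph P) (ind B) (ind D) <-> #|B :\: D| = 1%N.
Proof.
move=> BM DM; split.
- move=> [BD [F [[c [d [Pd FE]]] dF FB FD]]].
  have BD0 : B :\: D != finset.set0.
    by apply/negP => /eqP BD0; apply: BD; rewrite (basisD0 BM DM) // BD0 cards0.
  have [a] := set0Pn _ BD0; rewrite finset.inE => /andP[aD aB].
  have [b [bD bB CM C'M]] := exchange_basis BM DM aB aD.
  have sumE : ind (exch B a b) + ind (exch D b a) = ind B + ind D.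
    apply/rowP => i; rewrite !mxE !indicatorE !in_exch.
    case: (i =P b) => [->|_]; first by rewrite (negPf bB) (mem_neq aB bB) bD /=; ring.
    by case: (i =P a) => [->|_] //=; rewrite aB (negPf aD) /=; ring.
  (* The two exchanged bases have the same indicator sum as [B] and [D], so neither can fall below
     the maximum of [c]. *)
  have FC : F (ind (exch B a b)).
    move: FB FD; rewrite FE => -[_ cB] [_ cD]; split; first exact: indicator_polytope.
    have := Pd _ (indicator_polytope CM); have := Pd _ (indicator_polytope C'M).
    by have := congr1 (dotv c) sumE; rewrite !dotvDr => ? ? ?; lra.
  (* A second element [a2] of [B :\: D] contradicts dimension 1: at [a2] the direction towards
     [exch B a b] vanishes, the one towards [D] does not. *)
  apply/eqP; rewrite eqn_leq card_gt0 BD0 andbT leqNgt; apply/negP => BD2.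
  have [a2] : exists2 a2, a2 \in B :\: D & a2 != a.
    have [a2] : exists a2, a2 \in (B :\: D) :\ a.
      by apply/set0Pn; rewrite -card_gt0; move: BD2; rewrite (cardsD1 a) finset.inE aB aD.
    by rewrite 2!finset.inE => /andP[? ?]; exists a2.
  rewrite finset.inE => /andP[a2D a2B] a2a.
  have F0 : F !=set0 by exists (ind B).
  have uF : ind B - ind (exch B a b) \in direction F by apply: mem_direction.
  have vF : ind B - ind D \in direction F by apply: mem_direction.
  have u0 : ind B - ind (exch B a b) != 0.
    rewrite subr_eq0; apply/eqP => /(@indicator_inj R) BC.
    by have := aB; rewrite BC in_exch eqxx orbF eq_sym (mem_neq aB bB).
  have dirE : (<[ind B - ind (exch B a b)]> = direction F)%VS.
    apply/eqP; rewrite eqEdim -memvE uF dim_vline u0.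
    by move: dF; rewrite sdimE // => -[->].
  move: vF; rewrite -dirE => /vlineP[t /rowP/(_ a2)].
  rewrite !mxE !indicatorE in_exch a2B (negPf a2D) a2a /=.
  by rewrite orbT subrr mulr0 subr0 => /eqP; rewrite oner_eq0.
- move=> BD1.
  have e1 : #|D :\: B| = 1%N by rewrite (basisD_sym DM BM).
  have BnD : B != D by apply: contra_eqN BD1 => /eqP ->; rewrite finset.setDv cards0.
  have dE E : E \in bases M -> dotv (ind B + ind D) (ind E) =
      (#|E| + #|E| - (#|E :\: B| + #|E :\: D|))%:R.
    move=> EM; rewrite dotvDl !dotv_basis // -natrD.
    rewrite (basisD_sym BM EM) (basisD_sym DM EM) (card_basis BM EM) (card_basis DM EM).
    by congr _%:R; have := subset_leq_card (finset.subsetDl E B);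
       have := subset_leq_card (finset.subsetDl E D); lia.
  have far E : E \in bases M -> (#|E :\: B| + #|E :\: D| > 0)%N.
    move=> EM; rewrite lt0n addn_eq0; apply: contraNN BnD => /andP[/eqP EB /eqP ED].
    by rewrite -(basisD0 EM BM EB) (basisD0 EM DM ED).
  pose r := #|B|; have cE E : E \in bases M -> #|E| = r by move=> EM; apply: card_basis EM BM.
  (* On a basis [E] this functional is [r + r] minus the sum of the distances to [B] and [D]. That
     sum is positive, and equals 1 only at [B] and [D]. *)
  pose c := ind B + ind D; pose d : R := (r + r).-1%:R.
  have le E : E \in bases M -> dotv c (ind E) <= d.
    by move=> EM; rewrite dE // cE // ler_nat; have := far E EM; lia.
  have r0 : (0 < r)%N by have := subset_leq_card (finset.subsetDl B D); rewrite BD1.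
  pose F := [set x | P x /\ dotv c x = d].
  have FB : F (ind B).
    split; first exact: indicator_polytope.
    by rewrite dE // cE // finset.setDv cards0 BD1 subn1.
  have FD : F (ind D).
    split; first exact: indicator_polytope.
    by rewrite dE // cE // finset.setDv cards0 e1 subn1.
  have F0 : F !=set0 by exists (ind B).
  split; first by move/(@indicator_inj R)/eqP; apply/negP.
  exists F; split=> //; first by exists c, d; split=> //; apply: polytope_dotv_le.
  have dirE : (direction F = <[ind D - ind B]>)%VS.
    apply/eqP; rewrite eqEsubv; apply/andP; split; last by rewrite -memvE mem_direction.
    apply: (direction_sub (x0 := ind B)) => // x [Px cx].
    apply: (affine_hull_span (S := [set ind B; ind D])).
      by move=> _ [->|->]; rewrite ?subrr ?mem0v ?memv_line.
    have [k [p [w [Sp w0 w1 ->]]]] := polytope_face le Px cx.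
    exists k, p, w; split=> // i; have [E [EM] + <-] := Sp i.
    rewrite dE // cE // => /eqP; rewrite eqr_nat => /eqP h.
    have [EB|ED] : #|E :\: B| = 0%N \/ #|E :\: D| = 0%N.
      by have := far E EM; move: h r0; lia.
    - by left; rewrite (basisD0 EM BM EB).
    - by right; rewrite (basisD0 EM DM ED).
  rewrite sdimE // dirE dim_vline subr_eq0.
  by rewrite (inj_eq (@indicator_inj R n)) eq_sym BnD.
Qed.

End Polytope.

(** * Affine equivalence preserves dimension and face lattice *)

Section AffineEquivalence.
Local Open Scope classical_set_scope.
Variables (R : realType).

Definition affine_map n n' (v : 'rV[R]_n') (A : 'M[R]_(n, n')) (x : 'rV[R]_n) :=
  v + x *m A.

Lemma affine_map_comb n n' v (A : 'M[R]_(n, n')) k (w : 'I_k -> R) (p : 'I_k -> 'rV[R]_n) :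
  \sum_i w i = 1 ->
  affine_map v A (\sum_i w i *: p i) = \sum_i w i *: affine_map v A (p i).
Proof.
move=> w1; rewrite /affine_map; under [RHS]eq_bigr do rewrite scalerDr.
rewrite big_split -scaler_suml w1 scale1r mulmx_suml; congr (_ + _).
by apply: eq_bigr => i _; rewrite scalemxAl.
Qed.

Lemma dotv_affine_map n n' v (A : 'M[R]_(n, n')) c x :
  dotv c (affine_map v A x) = dotv c v + dotv (c *m A^T) x.
Proof.
rewrite dotvDr; congr (_ + _); rewrite /dotv.
under eq_bigr do rewrite mxE mulr_sumr; rewrite exchange_big /=.
apply: eq_bigr => i _; rewrite mxE mulr_suml; apply: eq_bigr => j _.
by rewrite mxE; ring.
Qed.

Lemma affine_map_conv n n' v (A : 'M[R]_(n, n')) (S : set 'rV[R]_n) (S' : set 'rV[R]_n') :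
  (forall x, S x -> S' (affine_map v A x)) ->
  forall x, conv S x -> conv S' (affine_map v A x).
Proof.
move=> SS' _ [k [p [w [Sp w0 w1 ->]]]]; exists k, (fun i => affine_map v A (p i)), w.
by split=> //; [move=> i; apply: SS'|apply: affine_map_comb].
Qed.

Lemma affine_map_id_conv n v (A : 'M[R]_n) (S : set 'rV[R]_n) :
  (forall x, S x -> affine_map v A x = x) ->
  forall x, conv S x -> affine_map v A x = x.
Proof.
move=> Sid _ [k [p [w [Sp _ w1 ->]]]]; rewrite affine_map_comb //.
by apply: eq_bigr => i _; rewrite Sid.
Qed.

Lemma affine_map_comp n n' n'' v (A : 'M[R]_(n, n')) v' (A' : 'M[R]_(n', n'')) x :
  affine_map v' A' (affine_map v A x) = affine_map (affine_map v' A' v) (A *m A') x.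
Proof. by rewrite /affine_map mulmxDl addrA mulmxA. Qed.

Section Faces.
Variables (n n' : nat) (P : set 'rV[R]_n) (P' : set 'rV[R]_n').
Variables (v : 'rV[R]_n') (A : 'M[R]_(n, n')) (v' : 'rV[R]_n) (A' : 'M[R]_(n', n)).
Hypothesis PP' : forall x, P x -> P' (affine_map v A x).
Hypothesis P'P : forall y, P' y -> P (affine_map v' A' y).
Hypothesis AK : forall x, P x -> affine_map v' A' (affine_map v A x) = x.
Hypothesis A'K : forall y, P' y -> affine_map v A (affine_map v' A' y) = y.

Lemma is_face_affine_image F : is_face P F -> is_face P' (affine_map v A @` F).
Proof.
(* The supporting functional is pulled back along the inverse map, whose constant part shifts the
   bound. *)
move=> [c [d [Pd ->]]]; exists (c *m A'^T), (d - dotv c v').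
have cE y : dotv (c *m A'^T) y = dotv c (affine_map v' A' y) - dotv c v'.
  by rewrite dotv_affine_map addrC addKr.
split=> [y P'y|]; first by rewrite cE lerD2r; apply/Pd/P'P.
apply/seteqP; split=> [_ [x [Px cx] <-]|y [P'y]].
  by split; [exact: PP'|rewrite cE AK // cx].
rewrite cE => /addIr cy; exists (affine_map v' A' y); last exact: A'K.
by split=> //; apply: P'P.
Qed.

Lemma affine_image_cancel F : F `<=` P -> affine_map v' A' @` (affine_map v A @` F) = F.
Proof.
move=> FP; apply/seteqP; split=> [_ [_ [x Fx <-] <-]|x Fx].
  by rewrite AK //; apply: FP.
by exists (affine_map v A x); [exists x|rewrite AK //; apply: FP].
Qed.

(** The linear part [A] maps the direction of [P] onto a space containing that of [P']; rank-nullity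
    bounds the dimension. *)
Lemma sdim_affine_le : P !=set0 -> sdim P' <= sdim P.
Proof.
move=> [x0 Px0]; have Px0' := PP' Px0.
rewrite !sdimE; [|by exists x0|by eexists; exact: Px0'].
rewrite lez_nat -(limg_ker_dim (linfun (mulmxr A)) (direction P)).
apply: leq_trans (leq_addl _ _); apply: dimvS.
apply: (direction_sub (x0 := affine_map v A x0)); first by eexists; exact: Px0'.
move=> y P'y; rewrite -(A'K P'y).
have -> : affine_map v A (affine_map v' A' y) - affine_map v A x0 =
    linfun (mulmxr A) (affine_map v' A' y - x0).
  by rewrite lfunE /= /affine_map mulmxBl; rewrite opprD addrACA subrr add0r.
by apply: memv_img; apply: mem_direction => //; apply: P'P.
Qed.

End Faces.

Lemma is_face_sub n (P F : set 'rV[R]_n) : is_face P F -> F `<=` P.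
Proof. by move=> [c [d [_ ->]]] x []. Qed.

Lemma affine_combinatorially_equivalent n n' (P : set 'rV[R]_n) (P' : set 'rV[R]_n') v A v' A' :
  (forall x, P x -> P' (affine_map v A x)) -> (forall y, P' y -> P (affine_map v' A' y)) ->
  (forall x, P x -> affine_map v' A' (affine_map v A x) = x) ->
  (forall y, P' y -> affine_map v A (affine_map v' A' y) = y) ->
  combinatorially_equivalent P P'.
Proof.
move=> PP' P'P AK A'K.
have fK F : is_face P F -> affine_map v' A' @` (affine_map v A @` F) = F.
  by move=> FP; exact: (affine_image_cancel AK (is_face_sub FP)).
exists (fun F => affine_map v A @` F).
  split.
  - by move=> F FP; exact: (is_face_affine_image PP' P'P AK A'K FP).
  - move=> F G; rewrite !inE => FP GP FG.
    by rewrite -(fK _ FP) FG fK.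
  - move=> F FP'; exists (affine_map v' A' @` F).
      exact: (is_face_affine_image P'P PP' A'K AK FP').
    exact: (affine_image_cancel A'K (is_face_sub FP')).
move=> F G FP GP; split; first exact: image_subset.
by move=> /(@image_subset _ _ (affine_map v' A')); rewrite !fK.
Qed.

End AffineEquivalence.

(** * From a graph isomorphism to inverse affine maps *)

Theorem theorem18 (R : realType) (n n' : nat) (M : matroid n) (M' : matroid n') :
  graph_isomorphic (vertex_edge_graph (matroid_polytope R M))
                   (vertex_edge_graph (matroid_polytope R M')) ->
  sdim (matroid_polytope R M) = sdim (matroid_polytope R M') /\
  combinatorially_equivalent (matroid_polytope R M) (matroid_polytope R M').
Proof.
move=> [f [f_fun f_inj f_surj] f_adj].
have ind_vert m (N : matroid m) B : B \in bases N ->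
    vert (vertex_edge_graph (matroid_polytope R N)) (indicator R B).
  by move=> BN; apply/vertexP; exists B.
(* Via [vertexP], [f] and its inverse become maps [g] and [h] on sets; the empty set is a dummy
   value off the bases. *)
have /choice[g gP] : forall B, exists C, B \in bases M ->
    C \in bases M' /\ indicator R C = f (indicator R B).
  move=> B; have [BM|BM] := boolP (B \in bases M); last by exists finset.set0.
  have /vertexP[C CM fC] := f_fun _ (ind_vert _ M B BM).
  by exists C.
have /choice[h hP] : forall C, exists B, C \in bases M' ->
    B \in bases M /\ f (indicator R B) = indicator R C.
  move=> C; have [CM|CM] := boolP (C \in bases M'); last by exists finset.set0.
  have [_ /vertexP[B BM ->] fB] := f_surj _ (ind_vert _ M' C CM).
  by exists B.
have gM : {in bases M, forall B, g B \in bases M'} by move=> B /gP[].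
have hM : {in bases M', forall C, h C \in bases M} by move=> C /hP[].
have gh : {in bases M', cancel h g}.
  move=> C CM; apply: (@indicator_inj R).
  by rewrite (gP _ (hM _ CM)).2 (hP _ CM).2.
have hg : {in bases M, cancel g h}.
  move=> B BM; apply: (@indicator_inj R); apply: f_inj; rewrite ?inE.
  - exact/ind_vert/hM/gM.
  - exact: ind_vert.
  - by rewrite (hP _ (gM _ BM)).2 (gP _ BM).2.
have g1 : {in bases M &, forall D E, #|D :\: E| = 1%N <-> #|g D :\: g E| = 1%N}.
  move=> D E DM EM; rewrite -(adjP R DM EM) -(adjP R (gM _ DM) (gM _ EM)).
  by rewrite (gP _ DM).2 (gP _ EM).2; apply: f_adj; apply: ind_vert.
have h1 : {in bases M' &, forall D E, #|D :\: E| = 1%N <-> #|h D :\: h E| = 1%N}.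
  by move=> D E DM EM; rewrite g1 ?hM // !gh.
have [v [A TA]] := basis_graph_affine R gM (can_in_inj hg) g1.
have [v' [A' TA']] := basis_graph_affine R hM (can_in_inj gh) h1.
have PP' : forall x, matroid_polytope R M x -> matroid_polytope R M' (affine_map v A x).
  by apply: affine_map_conv => _ [B BM <-]; exists (g B); [exact: gM|exact: TA].
have P'P : forall y, matroid_polytope R M' y -> matroid_polytope R M (affine_map v' A' y).
  by apply: affine_map_conv => _ [B BM <-]; exists (h B); [exact: hM|exact: TA'].
(* The two affine maps need not be inverse on the ambient spaces, but the composite fixes the
   indicators of bases, hence their convex hull. *)
have AK x : matroid_polytope R M x -> affine_map v' A' (affine_map v A x) = x.
  rewrite affine_map_comp; apply: affine_map_id_conv => _ [B BM <-].
  by rewrite -affine_map_comp /affine_map -TA // -TA' ?gM // hg.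
have A'K y : matroid_polytope R M' y -> affine_map v A (affine_map v' A' y) = y.
  rewrite affine_map_comp; apply: affine_map_id_conv => _ [B BM <-].
  by rewrite -affine_map_comp /affine_map -TA' // -TA ?hM // gh.
have ne m (N : matroid m) : (matroid_polytope R N !=set0)%classic.
  have /set0Pn[B BN] := bases_neq0 N.
  by exists (indicator R B); apply: indicator_polytope.
split; last exact: affine_combinatorially_equivalent PP' P'P AK A'K.
apply/le_anti/andP; split.
- exact: (sdim_affine_le P'P PP' AK (ne _ M')).
- exact: (sdim_affine_le PP' P'P A'K (ne _ M)).
Qed.
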